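(* Let $A,B\in\mathbb{S}^n$. Then for every $\epsilon>0$, there exist $\tilde A,\tilde B\in\mathbb{S}^n$ such that $\|A-\tilde A\|\le\epsilon$, $\|B-\tilde B\|\leq \epsilon$ and $\{\tilde A,\tilde B\}$ is $1$-RSDC. Furthermore, if $A$ is invertible and $A^{-1}B$ has simple eigenvalues, then $\{A,B\}$ is itself $1$-RSDC.
   Context: $\mathbb{S}^n$ denotes the real vector space of $n\times n$ real symmetric matrices and $\|\cdot\|$ the spectral norm. A matrix has simple eigenvalues if its (complex) eigenvalues all have algebraic multiplicity one. A set $\mathcal{A}\subseteq\mathbb{S}^n$ is simultaneously diagonalizable via congruence (SDC) if there exists an invertible $P\in\mathbb{R}^{n\times n}$ such that $P^\top A P$ is diagonal for all $A\in\mathcal{A}$. For an integer $d\ge 1$, a set $\mathcal{A}\subseteq\mathbb{S}^n$ is $d$-restricted SDC ($d$-RSDC) if there exist matrices $\bar A\in\mathbb{S}^{n+d}$, one for every $A\in\mathcal{A}$, with $\bar A$ containing $A$ as its top-left $n\times n$ principal submatrix, such that $\{\bar A: A\in\mathcal{A}\}$ is SDC. *)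

(* Defs.v *)
From mathcomp Require Import all_boot all_order all_algebra.
From mathcomp Require Import complex.
From mathcomp Require Import classical_sets reals.

Set Implicit Arguments.
Unset Strict Implicit.
Unset Printing Implicit Defensive.

Import Order.TTheory GRing.Theory Num.Theory.

Local Open Scope ring_scope.
Local Open Scope classical_set_scope.
Local Open Scope complex_scope.

Definition norm2 (R : realType) (n : nat) (x : 'cV[R]_n) : R :=
  Num.sqrt (\sum_(i < n) x i 0 ^+ 2).

(* The norm `|M| that analysis puts on matrices is the entrywise maximum; the
   spectral norm is the operator norm induced by norm2. The set below contains
   0 and is bounded above, so sup is its genuine least upper bound. *)
Definition spectral_norm (R : realType) (n : nat) (M : 'M[R]_n) : R :=
  sup [set norm2 (M *m x) | x in [set x : 'cV[R]_n | norm2 x <= 1]].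

Definition simple_eigenvalues (R : realType) (n : nat) (M : 'M[R]_n) : Prop :=
  let MC : 'M[R[i]]_n := map_mx (real_complex R) M in
  forall z : R[i], eigenvalue MC z -> mup z (char_poly MC) = 1%N.

Definition SDC (R : realType) (n : nat) (cA : set 'M[R]_n) : Prop :=
  exists P : 'M[R]_n, P \in unitmx /\
    forall A, cA A -> is_diag_mx (P^T *m A *m P).

Definition RSDC (R : realType) (d n : nat) (cA : set 'M[R]_n) : Prop :=
  exists bar : 'M[R]_n -> 'M[R]_(n + d),
    (forall A, cA A -> bar A \is symmetricmx /\ ulsubmx (bar A) = A) /\
    SDC (bar @` cA).

(* Main.v *)
Require Import Defs.
From mathcomp Require Import all_boot all_order all_algebra.
From mathcomp Require Import separable ring lra.
From mathcomp Require Import classical_sets reals.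
Import Order.TTheory GRing.Theory Num.Theory.
From mathcomp Require Import complex.

(** A pencil [(S, T)] of real symmetric matrices with [S] invertible is
    simultaneously diagonalized by congruence as soon as [v T = e v S] has as
    many distinct real eigenvalues [e] as the dimension: eigenvectors of
    distinct eigenvalues are orthogonal for the bilinear form [S], hence for
    [T]. So it suffices to border [(A, B)] by one row and one column in such a
    way that all [n + 1] eigenvalues of the new pencil become real and distinct.

    Suppose that the eigenvalues [l_i] of [A^-1 B] are distinct; take an
    eigenbasis [v_i] over the complex numbers and let [J] index the eigenvalues
    of positive imaginary part. Border [A] by zeros and a corner [1], and [B]
    by [b = w A] and a corner [beta], where
    [w = sum_(j in J) c_j v_j + complex conjugate] is a real vector. A vector
    [(y, 0)] with [y] an eigenvector of a real [l_i] stays an eigenvector, by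
    orthogonality of [y] and [w]. A real [mu] which is no eigenvalue of
    [A^-1 B] is an eigenvalue of the bordered pencil, with eigenvector [(y, 1)]
    for the unique [y] solving [y (B - mu A) = - b], if and only if the
    secular equation
    [mu - beta = sum_(j in J) c_j^2 d_j / (mu - l_j) + complex conjugate]
    holds, where [d_j = v_j A v_j^T != 0]. Over the complex numbers every number
    is a square, so the residues [c_j^2 d_j] are arbitrary, and by partial
    fractions the equation can be given any [2 #|J| + 1] prescribed real
    solutions: divide the monic polynomial with these roots by
    [prod_(j in J) (X - l_j) (X - conj l_j)]. Together with the real [l_i]
    this makes [n + 1] eigenvalues ([bordered_real_pencil]).

    For the approximation statement, move [(A, B)] along the segment towards
    [(1, diag (0, 1, ..., n - 1))]. That the first matrix is invertible and that
    [adj A' B'], a multiple of [A'^-1 B'], has a separable characteristic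
    polynomial means that a determinant and a resultant do not vanish. These
    are polynomials in the parameter, nonzero at the end of the segment, so
    arbitrarily small parameters avoid their roots
    ([nearby_separable_pencil]). *)

Local Open Scope ring_scope.
Local Open Scope complex_scope.

(** * Eigenvectors of a symmetric pencil *)

(** Both [a] and [b] can be pulled out of [u B v^T], by symmetry of [A] and [B]. *)
Lemma pencil_orthogonal {F : fieldType} {n : nat} {A B : 'M[F]_n}
    {a b : F} {u v : 'rV[F]_n} :
  A^T = A -> B^T = B -> a != b ->
  u *m B = a *: (u *m A) -> v *m B = b *: (v *m A) -> u *m A *m v^T = 0.
Proof.
move=> sA sB ab uB vB; apply/eqP.
have: (a - b) *: (u *m A *m v^T) == 0.
  rewrite scalerBl [a *: _]scalemxAl -uB -!mulmxA -[X in X *m v^T]sB -trmx_mul.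
  by rewrite vB linearZ /= trmx_mul sA -scalemxAr mulmxA subrr.
by rewrite scaler_eq0 subr_eq0 (negPf ab).
Qed.

(** The rows [v_i A] are eigenvectors of [A^-1 B] for distinct eigenvalues, and
    eigenspaces are in direct sum. *)
Lemma pencil_eigenbasis {F : fieldType} {n : nat} {A B : 'M[F]_n}
    {l : 'I_n -> F} :
  A \in unitmx -> injective l ->
  (forall i, exists2 v : 'rV[F]_n, v != 0 & v *m B = l i *: (v *m A)) ->
  exists2 V : 'M[F]_n, V \in unitmx &
    forall i, row i V *m B = l i *: (row i V *m A).
Proof.
move=> uA l_inj /fin_all_exists2[v v0 vB].
exists (\matrix_i v i) => [|i]; last by rewrite rowK.
rewrite -row_free_unit -kermx_eq0; apply/rowV0P => u /sub_kermxP uV.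
have sumu : \sum_i u 0 i *: (v i *m A) = 0.
  transitivity (u *m (\matrix_i v i) *m A); last by rewrite uV mul0mx.
  rewrite [u *m _]mulmx_sum_row mulmx_suml; apply: eq_bigr => i _.
  by rewrite rowK scalemxAl.
have dx : mxdirect (\sum_i eigenspace (invmx A *m B) (l i)).
  by apply: mxdirect_sum_eigenspace => i j _ _; apply: l_inj.
have sub i : (u 0 i *: (v i *m A) <= eigenspace (invmx A *m B) (l i))%MS.
  by apply/scalemx_sub/eigenspaceP; rewrite mulmxA mulmxK.
have [C _ _ Cuniq] := sub_dsumsmx dx (sub0mx 1 _).
apply/rowP => i; rewrite mxE; apply/eqP.
have : u 0 i *: (v i *m A) = 0.
  rewrite (Cuniq (fun i => u 0 i *: (v i *m A)) (fun j _ => sub j)) //.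
  by rewrite -(Cuniq (fun=> 0)) // ?big1 // => j _; apply: sub0mx.
move/eqP; rewrite scaler_eq0 => /orP[//|/eqP vA0].
by case/eqP: (v0 i); rewrite -(mulmxK uA (v i)) vA0 mul0mx.
Qed.

Lemma pencil_eigenvalueP {F : fieldType} {n : nat} {A B : 'M[F]_n} {a : F} :
  A \in unitmx ->
  reflect (exists2 v : 'rV[F]_n, v != 0 & v *m B = a *: (v *m A))
          (eigenvalue (invmx A *m B) a).
Proof.
move=> uA; apply: (iffP eigenvalueP) => [[v vM v0]|[v v0 vB]].
  exists (v *m invmx A); last by rewrite -mulmxA vM mulmxKV.
  by apply: contra v0 => /eqP v0; rewrite -(mulmxKV uA v) v0 mul0mx.
exists (v *m A); first by rewrite mulmxA mulmxK.
by apply: contra v0 => /eqP v0; rewrite -(mulmxK uA v) v0 mul0mx.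
Qed.

(** An eigenvector is [A]-orthogonal to all the others; were it isotropic too, it
    would lie in the radical of the nondegenerate form [A]. *)
Lemma pencil_eigenbasis_anisotropic {F : fieldType} {n : nat} {A B V : 'M[F]_n}
    {l : 'I_n -> F} :
  A^T = A -> B^T = B -> A \in unitmx -> V \in unitmx -> injective l ->
  (forall i, row i V *m B = l i *: (row i V *m A)) ->
  forall i, (row i V *m A *m (row i V)^T) 0 0 != 0.
Proof.
move=> sA sB uA uV l_inj VB i; apply/eqP => d0.
have : row i V *m A *m V^T = 0.
  apply/rowP => j; transitivity ((row i V *m A *m (row j V)^T) 0 0).
    by rewrite !mxE; apply: eq_bigr => k _; rewrite !mxE.
  have [<-|ij] := eqVneq i j; first by rewrite d0 mxE.
  by rewrite (pencil_orthogonal sA sB _ (VB i) (VB j)) ?mxE // (inj_eq l_inj).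
move=> /(congr1 (mulmx^~ (invmx V^T *m invmx A))).
rewrite mul0mx mulmxA mulmxK ?unitmx_tr // mulmxK // rowE => e0.
have /eqP : delta_mx 0 i = 0 :> 'rV[F]_n.
  by rewrite -(mulmxK uV (delta_mx _ _)) e0 mul0mx.
by move/eqP/rowP/(_ i)/eqP; rewrite !mxE !eqxx oner_eq0.
Qed.

(** * Partial fractions with prescribed zeros *)

(** If [h] is the product of the ['X - rho_t] then [r / h] has a partial fraction
    decomposition [X - b + sum_t e_t / (X - rho_t)], by Lagrange interpolation
    at the poles; the conclusion says that it vanishes at the roots of [r]. *)
Lemma partial_fraction_roots {F : fieldType} {T : finType} {rho : T -> F}
    {r : {poly F}} :
  injective rho -> r \is monic -> size r = #|T|.+2 ->
  exists (b : F) (e : T -> F), forall x, root r x -> (forall t, x != rho t) ->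
    x + \sum_t e t / (x - rho t) = b.
Proof.
move=> rho_inj r_mon r_size.
pose h := \prod_t ('X - (rho t)%:P).
pose g t := \prod_(s | s != t) ('X - (rho s)%:P).
have hg t : h = ('X - (rho t)%:P) * g t by rewrite /h (bigD1 t).
have h_size : size h = #|T|.+1.
  by rewrite size_prod_XsubC cardE enumT [index_enum T]unlock.
have g_size t : size (g t) = #|T|.
  have := h_size; rewrite (hg t) size_monicM ?monicXsubC ?size_XsubC //.
    by case.
  exact/monic_neq0/monic_prod_XsubC.
have gg t : (g t).[rho t] != 0.
  rewrite horner_prod; apply/prodf_neq0 => s; rewrite !hornerE subr_eq0.
  by apply: contra => /eqP/rho_inj ->.
(* Residue of r / h at the simple pole rho t. *)
pose e t := r.[rho t] / (g t).[rho t].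
pose p := r - 'X * h - \sum_t e t *: g t.
have h_mon : h \is monic by apply: monic_prod_XsubC.
have h_dvd : h %| p.
  rewrite /h -(big_map rho xpredT (fun x => 'X - x%:P)).
  apply: uniq_roots_dvdp; last first.
    by rewrite uniq_rootsE map_inj_uniq ?index_enum_uniq.
  apply/allP => _ /mapP[t _ ->]; rewrite rootE !hornerD !hornerN (hg t).
  rewrite !hornerM hornerXsubC subrr mul0r mulr0 subr0.
  rewrite horner_sum (bigD1 t) //= big1 => [|s st].
    by rewrite hornerZ divfK ?gg // addr0 subrr.
  rewrite hornerZ horner_prod (bigD1 t) //= 1?eq_sym //.
  by rewrite hornerXsubC subrr mul0r mulr0.
have p_size : (size p <= #|T|.+1)%N.
  rewrite (leq_trans (size_polyD _ _)) // geq_max size_polyN; apply/andP; split.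
    have Xh_mon : 'X * h \is monic by rewrite monicMl ?monicX.
    have Xh_size : size ('X * h) = #|T|.+2.
      by rewrite mulrC size_mulX ?monic_neq0 // h_size.
    apply/leq_sizeP => j; rewrite leq_eqVlt coefB => /orP[/eqP <-|ltj].
      have := monicP r_mon; rewrite lead_coefE r_size /= => ->.
      by have := monicP Xh_mon; rewrite lead_coefE Xh_size /= => ->; apply: subrr.
    by rewrite !nth_default ?subrr // ?r_size ?Xh_size.
  rewrite (leq_trans (size_sum _ _ _)) //; apply/bigmax_leqP => t _.
  by rewrite (leq_trans (size_scale_leq _ _)) // g_size.
have [c pE] : exists c : F, p = c *: h.
  have [q pE] := dvdpP _ _ h_dvd.
  suff : (size q <= 1)%N.
    by move/size1_polyC => q1; exists q`_0; rewrite pE {1}q1 mul_polyC.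
  have [->|q0] := eqVneq q 0; first by rewrite size_poly0.
  move: p_size; rewrite pE size_Mmonic // h_size addnS /= -[X in (_ <= X)%N]add1n.
  by rewrite leq_add2r.
exists (- c), e => x /eqP rx x_rho.
have hx : h.[x] != 0.
  rewrite horner_prod; apply/prodf_neq0 => s _; rewrite !hornerE subr_eq0.
  exact: x_rho.
have := congr1 (horner^~ x) pE.
rewrite !hornerE rx horner_sum sub0r => px.
apply: (mulIf hx); rewrite mulNr -px opprB opprK addrC mulrDl mulr_suml.
congr (_ + _); apply: eq_bigr => t _; rewrite hornerZ (hg t) hornerM hornerXsubC.
by rewrite mulrA divfK // subr_eq0.
Qed.

(** The case of complex conjugate poles and real zeros. Averaging the
    decomposition with its complex conjugate makes the residues at conjugate
    poles conjugate and the constant term real. *)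
Lemma conj_partial_fraction_roots {R : rcfType} {J : finType} {l : J -> R[i]}
    {mu : 'I_(#|J| + #|J|).+1 -> R} :
  injective l -> (forall j, 0 < Im (l j)) -> injective mu ->
  exists (b : R) (z : J -> R[i]), forall k,
    let s := \sum_j z j / ((mu k)%:C - l j) in (mu k)%:C + (s + conjc s) = b%:C.
Proof.
move=> l_inj l_im mu_inj.
pose rho (t : J + J) := match t with inl j => l j | inr j => (l j)^* end.
have conj_im (x : R[i]) : Im x^* = - Im x by case: x.
have rho_inj : injective rho.
  move=> [i|i] [j|j] /= ij; first by rewrite (l_inj _ _ ij).
  - by have := l_im i; rewrite ij conj_im oppr_gt0 ltNge ltW.
  - by have := l_im j; rewrite -ij conj_im oppr_gt0 ltNge ltW.
  - by rewrite (l_inj _ _ (can_inj (@conjcK R) ij)).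
pose r := \prod_k ('X - (mu k)%:C%:P).
have [||b [e be]] := @partial_fraction_roots _ _ _ r rho_inj.
- exact: monic_prod_XsubC.
- by rewrite size_prod_XsubC [index_enum _]unlock -enumT size_enum_ord card_sum.
(* The average of the residue at l j and of the conjugate of the residue at
   the conjugate pole. *)
pose z j := (e (inl j) + conjc (e (inr j))) / 2.
have rho_mu k t : (mu k)%:C != rho t.
  case: t => j; apply/eqP => /(congr1 (@Im R)) /=; rewrite ?conj_im => E;
    by have := l_im j; rewrite -?E ?ltxx // -oppr_lt0 -E ltxx.
exists (Re b), z => k /=.
have {}be := be (mu k)%:C _ (rho_mu k).
have rmu : root r (mu k)%:C.
  rewrite /r (bigD1 k) //= rootM root_XsubC eqxx //.
have {be rmu} := be rmu; rewrite big_sumType /rho /= => be.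
set m := (mu k)%:C in be *; set s := \sum_j z j / _.
set s1 := \sum_i _ in be; set s2 := \sum_i _ in be.
have mJ : conjc m = m by apply: conjc_real.
clearbody m.
have -> : s = (s1 + conjc s2) / 2.
  rewrite rmorph_sum -big_split mulr_suml; apply: eq_bigr => j _ /=.
  rewrite rmorphM /= fmorphV /= rmorphB /= conjcK mJ.
  by rewrite -mulrDl /z mulrAC.
have conj_half (x : R[i]) : conjc (x / 2) = conjc x / 2.
  by rewrite rmorphM fmorphV rmorph_nat.
rewrite conj_half ReJ_add -be !rmorphD /= conjcK mJ.
by field.
Qed.

(** * Bordering a pencil so that its spectrum becomes real *)

(** Conjugation exchanges the eigenvalues in the two open half planes. *)
Lemma card_real_conj_pairs {R : rcfType} {n : nat} {l : 'I_n -> R[i]} :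
  injective l -> (forall i, exists j, l j = conjc (l i)) ->
  (#|{: {i | Im (l i) == 0%R}}| +
    (#|{: {i | (0 < Im (l i))%R}}| + #|{: {i | (0 < Im (l i))%R}}|) = n)%N.
Proof.
move=> l_inj /fin_all_exists[s ls].
have s_im i : Im (l (s i)) = - Im (l i) by rewrite ls; case: (l i).
have s_inj : injective s.
  by move=> i j /(congr1 l); rewrite !ls => /(can_inj (@conjcK R))/l_inj.
have negE : #|[pred i | Im (l i) < 0]| = #|[pred i | 0 < Im (l i)]|.
  transitivity #|s @^-1: [set i | 0 < Im (l i)]|; last first.
    by rewrite card_preimset ?cardsE.
  by apply: eq_card => i; rewrite !inE s_im oppr_gt0.
rewrite !card_sig -[RHS]card_ord -(cardC [pred i | Im (l i) == 0]).
rewrite -[X in (_ = _ + X)%N](cardID [pred i | 0 < Im (l i)]).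
congr (_ + (_ + _))%N; last rewrite -negE; apply: eq_card => i; rewrite !inE.
  by case: ltrgt0P; rewrite ?eqxx.
by case: ltrgt0P.
Qed.

(** The factor 2 makes the complexification [p + conj p], without denominators. *)
Definition double_re {R : rcfType} {n : nat} (p : 'rV[R[i]]_n) : 'rV[R]_n :=
  map_mx (fun z => 2 * Re z) p.

Lemma map_double_re {R : rcfType} {n : nat} (p : 'rV[R[i]]_n) :
  map_mx (real_complex R) (double_re p) = p + map_mx conjc p.
Proof.
by apply/rowP => i; rewrite !mxE rmorphM rmorph_nat [RHS]addcJ.
Qed.

(** A real eigenvalue of a real matrix, even when it is found over the complex
    numbers, is a root of the real characteristic polynomial. *)
Lemma real_eigenvector {R : rcfType} {n : nat} {A B : 'M[R]_n} {z : R[i]} :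
  A \in unitmx ->
  eigenvalue (map_mx (real_complex R) (invmx A *m B)) z -> Im z = 0 ->
  exists2 v : 'rV[R]_n, v != 0 & v *m B = Re z *: (v *m A).
Proof.
move=> uA; rewrite eigenvalue_root_char => + z_im.
have -> : z = real_complex R (Re z) by case: z z_im => a b /= ->.
rewrite -map_char_poly fmorph_root -eigenvalue_root_char.
by move/(pencil_eigenvalueP uA).
Qed.

(** The heart of the proof: the eigenvalues of the bordered pencil are the real
    [l i], with their old eigenvectors, and as many freely chosen reals as
    there are nonreal [l i], plus one. *)
Lemma bordered_real_pencil {R : rcfType} {n : nat} {A B : 'M[R]_n}
    {l : 'I_n -> R[i]} :
  A^T = A -> B^T = B -> A \in unitmx -> injective l ->
  (forall i, eigenvalue (map_mx (real_complex R) (invmx A *m B)) (l i)) ->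
  (forall i, exists j, l j = conjc (l i)) ->
  exists (b : 'rV[R]_n) (beta : R) (e : 'I_(n + 1) -> R), injective e /\
    forall k, exists2 v : 'rV[R]_(n + 1), v != 0 &
      v *m block_mx B b^T b beta%:M = e k *: (v *m block_mx A 0 0 1%:M).
Proof.
move=> sA sB uA l_inj l_eig l_conj.
pose iota := real_complex R.
pose AC := map_mx iota A; pose BC := map_mx iota B.
have sAC : AC^T = AC by rewrite map_trmx sA.
have sBC : BC^T = BC by rewrite map_trmx sB.
have uAC : AC \in unitmx by rewrite map_unitmx.
have AJ : map_mx conjc AC = AC by apply/matrixP => i j; rewrite !mxE conjc_real.
have BJ : map_mx conjc BC = BC by apply/matrixP => i j; rewrite !mxE conjc_real.
have pencil_eig i : exists2 v : 'rV[R[i]]_n, v != 0 & v *m BC = l i *: (v *m AC).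
  by apply/pencil_eigenvalueP => //; have := l_eig i; rewrite map_mxM map_invmx.
have [V uV VB] := pencil_eigenbasis uAC l_inj pencil_eig.
have d0 := pencil_eigenbasis_anisotropic sAC sBC uAC uV l_inj VB.
pose d i := (row i V *m AC *m (row i V)^T) 0 0.
pose J := {i | (0 < Im (l i))%R}.
pose l' (j : J) := l (val j).
have l'_inj : injective l' by move=> i j /l_inj/val_inj.
have l'_im (j : J) : 0 < Im (l' j) by apply: (valP j).
(* The prescribed eigenvalues: any distinct reals that avoid the spectrum of
   invmx A *m B would do; these exceed all its real parts. *)
pose mu (k : 'I_(#|{: J}| + #|{: J}|).+1) : R := k.+1%:R + \sum_i `|Re (l i)|.
have mu_inj : injective mu.
  by move=> i j /addIr/eqP; rewrite eqr_nat => /eqP[/val_inj].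
have mu_re k i : Re (l i) != mu k.
  rewrite lt_eqF // (le_lt_trans (ler_norm _)) // /mu (bigD1 i) //= addrCA.
  by rewrite ltrDl ltr_wpDr ?ltr0Sn // sumr_ge0.
have [beta [z zE]] := conj_partial_fraction_roots l'_inj l'_im mu_inj.
pose v (j : J) := row (val j) V.
(* d j is nonzero, so the residue z j can be realized by a square; the sign
   is that of y = - b (B - mu A)^-1. *)
pose c (j : J) := sqrtc (- z j / d (val j)).
have cE j : c j ^+ 2 * d (val j) = - z j.
  by rewrite sqr_sqrtc divfK //; apply: d0.
pose p := \sum_j c j *: v j.
pose w := double_re p.
(* double_re (q k) is the solution y of y (B - mu k A) = - w A. *)
pose q k := \sum_j (c j / ((mu k)%:C - l' j)) *: v j.
pose K : finType := ({i | Im (l i) == 0%R} + 'I_(#|{: J}| + #|{: J}|).+1)%type.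
have K_card : #|{: K}| = (n + 1)%N.
  by rewrite card_sum card_ord addnS (card_real_conj_pairs l_inj l_conj) addn1.
pose e (t : K) : R := match t with inl i => Re (l (val i)) | inr k => mu k end.
have e_inj : injective e.
  move=> [i|i] [j|j] /= ij.
  - congr inl; apply/val_inj/l_inj/eqP; rewrite eq_complex ij eqxx.
    by rewrite (eqP (valP i)) (eqP (valP j)) eqxx.
  - by have := mu_re j (val i); rewrite ij eqxx.
  - by have := mu_re i (val j); rewrite ij eqxx.
  - by rewrite (mu_inj _ _ ij).
exists (w *m A), beta, (fun k => e (enum_val (cast_ord (esym K_card) k))).
split=> [i j /e_inj/enum_val_inj/cast_ord_inj //|k].
have blockE (y : 'rV[R]_n) (x a : R) :
    y *m B + x *: (w *m A) = a *: (y *m A) ->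
    (y *m A *m w^T) 0 0 + x * beta = a * x ->
  row_mx y x%:M *m block_mx B (w *m A)^T (w *m A) beta%:M
    = a *: (row_mx y x%:M *m block_mx A 0 0 1%:M).
  move=> E1 E2; rewrite !mul_row_block scale_row_mx !mulmx0 addr0 add0r mulmx1.
  rewrite mul_scalar_mx E1 -scalar_mxM trmx_mul sA mulmxA; congr row_mx.
  apply/rowP => i; rewrite !ord1 mxE [X in _ + X]mxE [RHS]mxE.
  by rewrite [X in _ = _ * X]mxE !eqxx !mulr1n.
case: (enum_val _) => [i|{}k].
  have [y y0 yB] := real_eigenvector uA (l_eig _) (eqP (valP i)).
  exists (row_mx y 0%:M).
    by rewrite row_mx_eq0 (negPf y0).
  apply: blockE; first by rewrite scale0r addr0.
  rewrite mul0r mulr0 addr0.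
  have yBC : map_mx iota y *m BC = l (val i) *: (map_mx iota y *m AC).
    rewrite -!map_mxM yB map_mxZ; congr (_ *: _).
    by apply/esym/eqP; rewrite eq_complex /= eqxx (valP i).
  have yp : map_mx iota y *m AC *m p^T = 0.
    rewrite linear_sum mulmx_sumr big1 // => j _.
    rewrite linearZ /= -scalemxAr (pencil_orthogonal sAC sBC _ yBC (VB _)).
      by rewrite scaler0.
    rewrite (inj_eq l_inj); apply/eqP => E; have := valP j.
    by rewrite -E (eqP (valP i)) ltxx.
  have : map_mx iota (y *m A *m w^T) = 0.
    rewrite !map_mxM -map_trmx map_double_re linearD mulmxDr /= yp add0r.
    have : map_mx conjc (map_mx iota y *m AC *m p^T) = 0 by rewrite yp map_mx0.
    have yJ : map_mx conjc (map_mx iota y) = map_mx iota y.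
      by apply/rowP => t; rewrite !mxE conjc_real.
    by rewrite !map_mxM AJ yJ -map_trmx.
  by move/eqP; rewrite map_mx_eq0 => /eqP ->; rewrite mxE.
exists (row_mx (double_re (q k)) 1%:M).
  by rewrite row_mx_eq0 negb_and oner_neq0 orbT.
have lmu j : (mu k)%:C - l' j != 0.
  rewrite subr_eq0; apply/eqP => E; have := l'_im j; rewrite -E /=.
  by rewrite ltxx.
have qB : q k *m BC + p *m AC = (mu k)%:C *: (q k *m AC).
  rewrite !mulmx_suml scaler_sumr -big_split; apply: eq_bigr => j _ /=.
  rewrite -!scalemxAl VB !scalerA -scalerDl; congr (_ *: _).
  rewrite -[l (val j)]/(l' j); have := lmu j.
  set m := (mu k)%:C; clearbody m => ?.
  by field.
have qBJ : map_mx conjc (q k) *m BC + map_mx conjc p *m AC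
    = (mu k)%:C *: (map_mx conjc (q k) *m AC).
  have := congr1 (map_mx conjc) qB.
  by rewrite map_mxD map_mxZ !map_mxM AJ BJ /= oppr0.
have qp : (q k *m AC *m p^T) 0 0 = - \sum_j z j / ((mu k)%:C - l' j).
  rewrite !mulmx_suml -sumrN summxE; apply: eq_bigr => j _.
  rewrite -!scalemxAl linear_sum mulmx_sumr (bigD1 j) //= big1 => [|s sj].
    rewrite addr0 linearZ /= -scalemxAr mxE [X in _ * X]mxE -/(d (val j)).
    rewrite -mulNr -cE; ring.
  rewrite linearZ /= -scalemxAr (pencil_orthogonal sAC sBC _ (VB _) (VB _)).
    by rewrite scaler0.
  by rewrite (inj_eq l_inj) (inj_eq val_inj) eq_sym.
have vBJ j : map_mx conjc (v j) *m BC = conjc (l' j) *: (map_mx conjc (v j) *m AC).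
  by have := congr1 (map_mx conjc) (VB (val j)); rewrite map_mxZ !map_mxM AJ BJ.
have qpJ : q k *m AC *m (map_mx conjc p)^T = 0.
  rewrite !mulmx_suml big1 // => j _.
  rewrite map_mx_sum linear_sum mulmx_sumr big1 // => s _.
  rewrite map_mxZ linearZ /= -scalemxAr -!scalemxAl.
  rewrite (pencil_orthogonal sAC sBC _ (VB _) (vBJ _)) ?scaler0 //.
  apply/eqP => E; have := l'_im j; rewrite [l' j]E.
  have := l'_im s; case: (l' s) => a b /=; lra.
have double_reP := @map_double_re R n.
apply: blockE.
  apply: (map_mx_inj (f := iota)).
  rewrite scale1r map_mxD map_mxZ !map_mxM !double_reP !mulmxDl scalerDr -qB.
  by rewrite -qBJ addrACA.
apply: (fmorph_inj iota).
rewrite mulr1 mul1r rmorphD /=.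
set s := \sum_j _ in qp.
(* Of the four products in (q + conj q) A (p + conj p)^T, the mixed ones vanish
   because l j and the conjugate of l s never coincide. *)
have qJp : map_mx conjc (q k) *m AC *m p^T = 0.
  have := congr1 (map_mx conjc) qpJ.
  rewrite !map_mxM AJ -map_trmx -map_mx_comp map_mx0.
  by rewrite (map_mx_id (@conjcK R)).
have qJpJ : (map_mx conjc (q k) *m AC *m (map_mx conjc p)^T) 0 0 = - conjc s.
  have := congr1 conjc qp; rewrite rmorphN /= => <-.
  transitivity ((map_mx conjc (q k *m AC *m p^T)) 0 0); last by rewrite [LHS]mxE.
  by rewrite !map_mxM AJ -map_trmx.
have -> : ((double_re (q k) *m A *m w^T) 0 0)%:C = - (s + conjc s).
  transitivity ((map_mx iota (double_re (q k) *m A *m w^T)) 0 0).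
    by rewrite [RHS]mxE.
  rewrite !map_mxM -map_trmx !double_reP linearD !mulmxDl !mulmxDr /= qpJ qJp.
  by rewrite addr0 add0r mxE qp qJpJ opprD.
have := zE k; rewrite /= -/s /iota /= => <-.
by rewrite [LHS]addrC addrK.
Qed.

(** * Restricted diagonalization from distinct eigenvalues *)

Lemma trmx_symmetricmx {F : fieldType} {n : nat} {A : 'M[F]_n} :
  reflect (A^T = A) (A \is symmetricmx).
Proof.
rewrite qualifE /= expr0 scale1r (map_mx_id (fun=> erefl)) eq_sym.
exact: eqP.
Qed.

Lemma SDC_of_distinct_pencil_eigenvalues {R : realType} {n : nat}
    {A B : 'M[R]_n} {e : 'I_n -> R} {cA : set 'M[R]_n} :
  A^T = A -> B^T = B -> A \in unitmx -> injective e ->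
  (forall i, exists2 v : 'rV[R]_n, v != 0 & v *m B = e i *: (v *m A)) ->
  (cA `<=` [set A; B])%classic -> SDC cA.
Proof.
move=> sA sB uA e_inj eP cAB.
have [V uV VB] := pencil_eigenbasis uA e_inj eP.
have diagA i j : i != j -> row i V *m A *m (row j V)^T = 0.
  move=> ij; apply: (pencil_orthogonal sA sB _ (VB i) (VB j)).
  by rewrite (inj_eq e_inj).
have coordE (M : 'M[R]_n) i j :
    (V *m M *m V^T) i j = (row i V *m M *m (row j V)^T) 0 0.
  rewrite -row_mul [LHS]mxE [RHS]mxE; apply: eq_bigr => k _.
  by rewrite [V^T _ _]mxE [row i _ _ _]mxE [(row j V)^T _ _]mxE [row j V _ _]mxE.
exists V^T; split=> [|M /cAB[->|->]]; first by rewrite unitmx_tr.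
  by apply/is_diag_mxP => i j ij; rewrite trmxK coordE diagA // mxE.
apply/is_diag_mxP => i j ij; rewrite trmxK coordE VB -scalemxAl diagA //.
by rewrite scaler0 mxE.
Qed.

(** The characteristic polynomial has at most [n] roots. *)
Lemma eigenvalues_exhaust {F : fieldType} {n : nat} {M : 'M[F]_n} {l : 'I_n -> F} :
  injective l -> (forall i, eigenvalue M (l i)) ->
  forall z, eigenvalue M z -> exists i, l i = z.
Proof.
move=> l_inj l_eig z; rewrite eigenvalue_root_char.
have := @all_roots_prod_XsubC _ (char_poly M) [seq l i | i <- enum 'I_n].
rewrite size_char_poly size_map size_enum_ord uniq_rootsE.
rewrite (map_inj_uniq l_inj) enum_uniq => -> //.
  rewrite (monicP (char_poly_monic _)) scale1r root_prod_XsubC => /mapP[i _ ->].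
  by exists i.
by apply/allP => _ /mapP[i _ ->]; rewrite -eigenvalue_root_char.
Qed.

Lemma RSDC_of_distinct_eigenvalues {R : realType} {n : nat} {A B : 'M[R]_n}
    {l : 'I_n -> R[i]} :
  A^T = A -> B^T = B -> A \in unitmx -> injective l ->
  (forall i, eigenvalue (map_mx (real_complex R) (invmx A *m B)) (l i)) ->
  RSDC 1 [set A; B]%classic.
Proof.
move=> sA sB uA l_inj l_eig.
have l_conj i : exists j, l j = conjc (l i).
  apply: (eigenvalues_exhaust l_inj l_eig).
  have := l_eig i; rewrite !eigenvalue_root_char -map_char_poly -complex_root_conj.
  congr (root _ _); apply/polyP => k.
  by rewrite !coef_map /= oppr0.
have [b [beta [e [e_inj eP]]]] := bordered_real_pencil sA sB uA l_inj l_eig l_conj.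
set T := block_mx B _ _ _ in eP; set S := block_mx A _ _ _ in eP.
have sS : S^T = S by rewrite tr_block_mx sA !trmx0 trmx1.
have sT : T^T = T by rewrite tr_block_mx sB trmxK tr_scalar_mx.
have uS : S \in unitmx.
  by rewrite unitmxE det_ublock det1 mulr1 -unitmxE.
(* Sending everything but A to T also handles A = B: the extensions of A and B
   then coincide, and any subset of {S, T} will do. *)
exists (fun X => if X == A then S else T); split=> [X [->|->]|].
- by rewrite eqxx; split; [apply/trmx_symmetricmx | rewrite block_mxKul].
- case: eqP => [->|_]; split; try exact/trmx_symmetricmx; by rewrite block_mxKul.
apply: (SDC_of_distinct_pencil_eigenvalues sS sT uS e_inj eP).
by move=> _ [X _ <-] /=; case: eqP; [left | right].
Qed.

Lemma simple_roots_separable {F : closedFieldType} {p : {poly F}} :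
  p \is monic -> (forall z, root p z -> mup z p = 1%N) -> separable_poly p.
Proof.
move=> p_mon p_simple; have [rs] := closed_field_poly_normal p.
rewrite (monicP p_mon) scale1r => pE; rewrite pE separable_prod_XsubC.
apply/count_mem_uniq => z; have := p_simple z.
rewrite pE root_prod_XsubC mu_prod_XsubC.
by case: (boolP (z \in rs)) => [_ -> //|/count_memPn ->].
Qed.

Lemma separable_distinct_roots {F : closedFieldType} {n : nat} {p : {poly F}} :
  p \is monic -> size p = n.+1 -> separable_poly p ->
  exists2 l : 'I_n -> F, injective l & forall i, root p (l i).
Proof.
move=> p_mon; have [rs] := closed_field_poly_normal p.
rewrite (monicP p_mon) scale1r => ->.
rewrite separable_prod_XsubC size_prod_XsubC => -[rs_size] rs_uniq.
exists (fun i : 'I_n => rs`_i) => [i j /eqP|i].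
  by rewrite nth_uniq ?rs_size // => /eqP/val_inj.
by rewrite root_prod_XsubC mem_nth ?rs_size.
Qed.

(** The scalar [c] is there for [c = \det A], which turns the inverse into the
    adjugate, whose entries are polynomials in those of [A]. *)
Lemma RSDC_of_separable {R : realType} {n : nat} {A B : 'M[R]_n} {c : R} :
  A^T = A -> B^T = B -> A \in unitmx -> c != 0 ->
  separable_poly (char_poly (map_mx (real_complex R) (c *: (invmx A *m B)))) ->
  RSDC 1 [set A; B]%classic.
Proof.
move=> sA sB uA c0 sep; set M := invmx A *m B in sep.
have [l l_inj l_root] :=
  separable_distinct_roots (char_poly_monic _) (size_char_poly _) sep.
have c0C : real_complex R c != 0 by rewrite fmorph_eq0.
apply: (@RSDC_of_distinct_eigenvalues _ _ _ _
  (fun i => (real_complex R c)^-1 * l i)) => //.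
  by move=> i j /(mulfI (invr_neq0 c0C))/l_inj.
move=> i; have := l_root i; rewrite -eigenvalue_root_char => /eigenvalueP[v vM v0].
apply/eigenvalueP; exists v => //; rewrite -scalerA -vM map_mxZ -scalemxAr.
by rewrite scalerA mulVf // scale1r.
Qed.

Lemma RSDC_of_simple_eigenvalues {R : realType} {n : nat} {A B : 'M[R]_n} :
  A^T = A -> B^T = B -> A \in unitmx -> simple_eigenvalues (invmx A *m B) ->
  RSDC 1 [set A; B]%classic.
Proof.
move=> sA sB uA simple.
apply: (RSDC_of_separable sA sB uA (oner_neq0 _)).
rewrite scale1r; apply: simple_roots_separable => [|z].
  exact: char_poly_monic.
by rewrite -eigenvalue_root_char; apply: simple.
Qed.

(** * Approximation by nondegenerate pencils *)

(** Otherwise [p] would vanish at [d / k] for all [k > 0]. *)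
Lemma exists_small_nonroot {R : realType} {p : {poly R}} {d : R} :
  p != 0 -> 0 < d -> exists t, [/\ 0 < t, t <= d & ~~ root p t].
Proof.
move=> p0 d0; pose rs := [seq d / k.+1%:R | k <- iota 0 (size p)].
have : ~~ all (root p) rs.
  apply/negP => rs_root; have := max_poly_roots p0 rs_root.
  rewrite size_map size_iota ltnn => /implyP.
  rewrite implybF map_inj_uniq ?iota_uniq //.
  move=> i j /(mulfI (lt0r_neq0 d0))/invr_inj/eqP.
  by rewrite eqr_nat => /eqP[].
rewrite -has_predC => /hasP[_ /mapP[k _ ->] nr].
exists (d / k.+1%:R); split=> //; first by rewrite divr_gt0 ?ltr0Sn.
by rewrite ler_pdivrMr ?ltr0Sn // ler_peMr ?ler1n // ltW.
Qed.

(** A crude bound, enough to see that the spectral norm of [t *: M] is small with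
    [t]: in the unit ball each coordinate is at most 1, and the Euclidean norm
    is at most the sum of the absolute values of the coordinates. *)
Lemma spectral_norm_le_sum {R : realType} {n : nat} (M : 'M[R]_n) :
  spectral_norm M <= \sum_i \sum_j `|M i j|.
Proof.
have norm2_le (y : 'cV[R]_n) : norm2 y <= \sum_i `|y i 0|.
  have S0 : 0 <= \sum_i `|y i 0| by apply: sumr_ge0.
  rewrite -[leRHS]ger0_norm // -sqrtr_sqr ler_wsqrtr // expr2 mulr_suml.
  apply: ler_sum => i _; rewrite -real_normK ?num_real // expr2; apply: ler_wpM2l => //.
  by rewrite (bigD1 i) //= lerDl sumr_ge0.
apply: ge_sup => [|_ [x x1 <-]].
  exists (norm2 (M *m 0)), 0 => //=.
  by rewrite /norm2 big1 ?sqrtr0 // => i _; rewrite mxE expr0n.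
apply: le_trans (norm2_le _) _; apply: ler_sum => i _.
rewrite mxE (le_trans (ler_norm_sum _ _ _)) //; apply: ler_sum => j _.
rewrite normrM ler_piMr // (le_trans _ x1) //.
rewrite -sqrtr_sqr ler_wsqrtr // (bigD1 j) //= lerDl sumr_ge0 // => k _.
exact: sqr_ge0.
Qed.

(** Specializing a resultant requires the leading coefficients to survive. The
    ring [S] is general because it will be a polynomial ring. *)
Lemma lead_coef_deriv_monic {S : nzRingType} {m : nat} {p : {poly S}} :
  p \is monic -> size p = m.+2 -> m.+1%:R != 0 :> S ->
  lead_coef p^`() = m.+1%:R.
Proof.
move=> p_mon p_size m0.
have pm : p^`()`_m = m.+1%:R.
  by rewrite coef_deriv; have := monicP p_mon; rewrite lead_coefE p_size /= => ->.
suff ps : size p^`() = m.+1 by rewrite lead_coefE ps.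
apply/eqP; rewrite eqn_leq; apply/andP; split.
  by rewrite -ltnS -p_size lt_size_deriv // monic_neq0.
by rewrite ltnNge; apply: contra m0 => /leq_sizeP/(_ _ (leqnn _)); rewrite pm => ->.
Qed.

Lemma separable_resultant {F : fieldType} {p : {poly F}} :
  p != 0 -> separable_poly p = (resultant p p^`() != 0).
Proof.
move=> p0; rewrite resultant_eq0 unlock /coprimep -leqNgt eqn_leq.
by rewrite [X in _ && X]lt0n size_poly_eq0 gcdp_eq0 (negPf p0) andbT.
Qed.

(** The adjugate, rather than the inverse, keeps the matrix polynomial in [t] and
    its characteristic polynomial monic over [{poly R}], so that the resultant
    with the derivative specializes correctly at every [t]. *)
Lemma nearby_separable_pencil {R : realType} {n : nat}
    {A B : 'M[R]_n.+1} {d : R} :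
  0 < d ->
  let D : 'M[R]_n.+1 := diag_mx (\row_i i%:R) in
  exists t : R, [/\ 0 < t, t <= d &
    let At := A + t *: (1%:M - A) in
    let Bt := B + t *: (D - B) in
    (At \in unitmx) && separable_poly (char_poly (\adj At *m Bt))].
Proof.
move=> d0 D.
pose path (M N : 'M[R]_n.+1) : 'M[{poly R}]_n.+1 :=
  map_mx polyC M + 'X *: map_mx polyC (N - M).
have path_at M N t : map_mx (horner_eval t) (path M N) = M + t *: (N - M).
  by apply/matrixP => i j; rewrite !mxE /horner_eval !hornerE.
pose chi := char_poly (\adj (path A 1%:M) *m path B D).
have chi_at t : map_poly (horner_eval t) chi =
    char_poly (\adj (A + t *: (1%:M - A)) *m (B + t *: (D - B))).
  by rewrite map_char_poly map_mxM map_mx_adj !path_at.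
have det_at t : (\det (path A 1%:M)).[t] = \det (A + t *: (1%:M - A)).
  by rewrite -path_at det_map_mx.
have res_at t : (resultant chi chi^`()).[t] != 0 =
    separable_poly (char_poly (\adj (A + t *: (1%:M - A)) *m (B + t *: (D - B)))).
  have chi_mon : chi \is monic by apply: char_poly_monic.
  rewrite separable_resultant ?monic_neq0 ?char_poly_monic // -chi_at deriv_map.
  rewrite -[LHS]/(horner_eval t _ != 0) map_resultant //.
    by rewrite (monicP chi_mon) rmorph1 oner_eq0.
  rewrite (lead_coef_deriv_monic chi_mon (size_char_poly _)) ?rmorph_nat ?pnatr_eq0 //.
  by rewrite -polyC_natr polyC_eq0 pnatr_eq0.
pose P := \det (path A 1%:M) * resultant chi chi^`().
(* At t = 1 the pencil is (1, D), whose eigenvalues are 0, ..., n. *)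
have P0 : P != 0.
  suff : P.[1] != 0 by apply: contraNneq => ->; rewrite horner0.
  rewrite hornerM mulf_neq0 ?det_at ?res_at // !scale1r !(addrC _ (_ - _)) !subrK.
    by rewrite det1 oner_neq0.
  have -> : \adj 1%:M *m D = D by rewrite -[\adj _]mul1mx mul_mx_adj det1 mul1mx.
  rewrite char_poly_trig ?diag_mx_is_trig //.
  rewrite -(big_map (fun i => D i i) xpredT (fun x => 'X - x%:P)).
  rewrite separable_prod_XsubC map_inj_uniq ?index_enum_uniq // => i j.
  rewrite !mxE !eqxx !mulr1n => /eqP; rewrite eqr_nat => /eqP/val_inj //.
have [t [t0 td]] := exists_small_nonroot P0 d0.
rewrite rootE hornerM mulf_eq0 negb_or det_at => /andP[At Bt].
exists t; split=> //=; rewrite unitmxE unitfE At /=.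
by rewrite -res_at.
Qed.

Lemma nearby_RSDC {R : realType} {n : nat} {A B : 'M[R]_n} {eps : R} :
  A^T = A -> B^T = B -> 0 < eps ->
  exists A' B' : 'M[R]_n, [/\ A'^T = A', B'^T = B',
    spectral_norm (A - A') <= eps, spectral_norm (B - B') <= eps
    & RSDC 1 [set A'; B']%classic].
Proof.
(* In dimension 0 the derivative of the characteristic polynomial is zero and
   the resultant is useless; but then the pencil itself will do. *)
case: n A B => [|n] A B sA sB eps0.
  exists A, B; split=> //;
    try by rewrite (le_trans (spectral_norm_le_sum _)) // big_ord0 ltW.
  apply: (@RSDC_of_distinct_eigenvalues _ _ _ _ (fun=> 0)) => //; last by case.
    by rewrite unitmxE det_mx00 unitr1.
  by case.
pose N (M : 'M[R]_n.+1) := \sum_i \sum_j `|M i j|.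
have N0 M : 0 <= N M by do 2![apply: sumr_ge0 => ? _].
pose D : 'M[R]_n.+1 := diag_mx (\row_i i%:R).
pose C := N (1%:M - A) + N (D - B) + 1.
have C0 : 0 < C by rewrite ltr_wpDl ?addr_ge0.
have d0 : 0 < eps / C by rewrite divr_gt0.
have [t [t0 td /= /andP[uA sep]]] := nearby_separable_pencil (A := A) (B := B) d0.
have normE (M M' : 'M[R]_n.+1) : N (M' - M) <= C ->
    spectral_norm (M - (M + t *: (M' - M))) <= eps.
  move=> NC; apply: le_trans (spectral_norm_le_sum _) _.
  have -> : \sum_i \sum_j `|(M - (M + t *: (M' - M))) i j| = t * N (M' - M).
    rewrite opprD addNKr mulr_sumr; apply: eq_bigr => i _; rewrite mulr_sumr.
    apply: eq_bigr => j _; rewrite !mxE normrN normrM.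
    by rewrite (ger0_norm (ltW t0)).
  apply: le_trans (ler_wpM2l (ltW t0) NC) _.
  by rewrite -ler_pdivlMr.
have sym_path (M M' : 'M[R]_n.+1) : M^T = M -> M'^T = M' ->
    (M + t *: (M' - M))^T = M + t *: (M' - M).
  by move=> sM sM'; rewrite linearD linearZ linearB /= sM sM'.
set A' := A + _ in uA sep; set B' := B + _ in sep.
have sA' : A'^T = A' := sym_path A 1%:M sA (trmx1 _ _).
have sB' : B'^T = B' := sym_path B D sB (tr_diag_mx _).
have detA' : \det A' != 0 by rewrite -unitfE -unitmxE.
exists A', B'; split=> //.
- by apply: normE; rewrite /C -addrA lerDl addr_ge0.
- by apply: normE; rewrite /C -addrA addrCA lerDl addr_ge0.
apply: (RSDC_of_separable sA' sB' uA detA').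
rewrite -map_char_poly separable_map.
suff -> : \det A' *: (invmx A' *m B') = \adj A' *m B' by [].
by rewrite scalemxAl /invmx uA scalerA mulfV ?scale1r.
Qed.

Local Open Scope classical_set_scope.

Theorem theorem4 (R : realType) (n : nat) (A B : 'M[R]_n)
    (symA : A \is symmetricmx) (symB : B \is symmetricmx) :
  (forall eps : R, 0 < eps ->
     exists A' B' : 'M[R]_n,
       [/\ A' \is symmetricmx, B' \is symmetricmx,
           spectral_norm (A - A') <= eps, spectral_norm (B - B') <= eps
         & RSDC 1 [set A'; B']])
  /\
  (A \in unitmx -> simple_eigenvalues (invmx A *m B) -> RSDC 1 [set A; B]).
Proof.
move/trmx_symmetricmx: symA => sA; move/trmx_symmetricmx: symB => sB.
split=> [eps eps0|]; last exact: RSDC_of_simple_eigenvalues.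
have [A' [B' [sA' sB' nA nB rsdc]]] := nearby_RSDC sA sB eps0.
by exists A', B'; split=> //; apply/trmx_symmetricmx.
Qed.
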